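(* There is a class of instances of the bi-criteria knapsack problem with groups (i.e. $d=1$ profit) with the following property: for every number $n$ of objects and every maximum density $\phi\ge 1$, the class contains an instance with $n$ objects whose profits are drawn independently according to densities bounded by $\phi$, and whose expected number of Pareto optimal solutions is \[ \Omega\left( \min\left\{ n^2 \phi^{1-\Theta(1/\phi)},\ 2^{\Theta(n)} \right\} \right). \]
   Context: Restricted multi-profit knapsack problem: there are $n$ objects $a_1,\dots,a_n$; object $a_i$ has a weight $w_i\in\mathbb{R}$ and a profit vector $p_i\in\mathbb{R}^d$. A solution is a vector $s\in\{0,1\}^n$, and a set $\mathcal{S}\subseteq\{0,1\}^n$ of feasible solutions is given. The objectives are to minimize the total weight $\sum_i w_i s_i$ and to maximize every total profit $\sum_i (p_i)_j s_i$, $j=1,\dots,d$, over $s\in\mathcal{S}$. A feasible solution $s'$ dominates a feasible solution $s$ if $s'$ is not worse than $s$ in any objective (weight not larger, each profit not smaller) and strictly better in at least one; a feasible solution is Pareto optimal if no feasible solution dominates it, and the Pareto set is the set of Pareto optimal solutions. In the knapsack problem with groups, the objects are partitioned into groups and $\mathcal{S}=\prod_{i=1}^k \mathcal{S}_i$ with $\mathcal{S}_i\subseteq\{0,1\}^{n_i}$, $\sum_i n_i=n$ (for each group one chooses independently one allowed subset). Smoothing model: the weights and the set $\mathcal{S}$ are chosen by an adversary, and each profit $(p_i)_j$ is drawn independently according to an adversarially chosen density $f_{i,j}:[-1,1]\to\mathbb{R}$ with $f_{i,j}\le\phi$. The bi-criteria case is $d=1$. *)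

(* Defs.v *)
From HB Require Import structures.
From mathcomp Require Import all_boot all_order all_algebra.
From mathcomp Require Import all_classical all_reals all_analysis.

Set Implicit Arguments.
Unset Strict Implicit.
Unset Printing Implicit Defensive.

Import Order.TTheory GRing.Theory Num.Theory.
Import numFieldNormedType.Exports.

Local Open Scope classical_set_scope.
Local Open Scope ring_scope.

(* A solution in {0,1}^n is represented by its support s : {set 'I_n}; a set
   of feasible solutions is S : {set {set 'I_n}}. *)

Section Pareto.
Context (R : realType) (n d : nat).
Variables (w : 'I_n -> R) (p : 'I_n -> 'I_d -> R).

Definition total_weight (s : {set 'I_n}) : R := \sum_(i in s) w i.

Definition total_profit (j : 'I_d) (s : {set 'I_n}) : R := \sum_(i in s) p i j.

Definition dominates (s' s : {set 'I_n}) : bool :=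
  [&& total_weight s' <= total_weight s,
      [forall j, total_profit j s <= total_profit j s'] &
      (total_weight s' < total_weight s)
      || [exists j, total_profit j s < total_profit j s']].

Definition pareto_set (S : {set {set 'I_n}}) : {set {set 'I_n}} :=
  [set s in S | [forall s' in S, ~~ dominates s' s]]%SET.

End Pareto.

(* The two fields ending in _wf make [choices G] a set of 0/1-vectors on the
   coordinates of the group G. *)
Record group_knapsack (R : realType) (n : nat) := GroupKnapsack {
  weight : 'I_n -> R;
  groups : {set {set 'I_n}};
  choices : {set 'I_n} -> {set {set 'I_n}};
  groups_wf : finset.partition groups [set: 'I_n]%SET;
  choices_wf : forall G, G \in groups -> choices G \subset powerset G
}.

(* The product of the [choices G] over the groups G. *)
Definition feasible (R : realType) (n : nat) (K : group_knapsack R n) :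
    {set {set 'I_n}} :=
  [set s : {set 'I_n} | [forall G in groups K, s :&: G \in choices K G]]%SET.

(* Only the values of f on [-1, 1] matter. *)
Definition is_density (R : realType) (f : R -> R) : Prop :=
  [/\ measurable_fun `[-1 : R, 1] f,
      forall x, x \in `[-1 : R, 1] -> 0 <= f x &
      (\int[lebesgue_measure]_(x in `[(-1)%R : R, 1%R]) (f x)%:E = 1)%E].

Record smoothed_instance (R : realType) (n d : nat) := SmoothedInstance {
  knapsack : group_knapsack R n;
  density : 'I_n -> 'I_d -> R -> R;
  density_wf : forall i j, is_density (density i j)
}.

Definition densities_bounded (R : realType) (n d : nat)
    (I : smoothed_instance R n d) (phi : R) : Prop :=
  forall i j x, x \in `[-1 : R, 1] -> density I i j x <= phi.

Definition has_density (R : realType) (dT : measure_display)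
    (T : measurableType dT) (P : probability T R) (X : {RV P >-> R})
    (f : R -> R) : Prop :=
  forall A : set R, measurable A ->
    (distribution P X A =
     \int[lebesgue_measure]_(x in A `&` `[(-1)%R : R, 1%R]) (f x)%:E)%E.

Definition mutually_independent (R : realType) (dT : measure_display)
    (T : measurableType dT) (P : probability T R) (J : finType)
    (X : J -> {RV P >-> R}) : Prop :=
  forall (F : {set J}) (A : J -> set R), (forall j, measurable (A j)) ->
    P (\bigcap_(j in [set` F]) (X j @^-1` A j)) =
    (\prod_(j in F) fine (P (X j @^-1` A j)))%:E.

(* [p i j] realizes the random profit (p_i)_j of the instance. *)
Definition random_profits (R : realType) (n d : nat)
    (I : smoothed_instance R n d) (dT : measure_display)
    (T : measurableType dT) (P : probability T R)
    (p : 'I_n -> 'I_d -> {RV P >-> R}) : Prop :=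
  mutually_independent (fun ij : 'I_n * 'I_d => p ij.1 ij.2) /\
  forall i j, has_density (p i j) (density I i j).

Definition num_pareto (R : realType) (n d : nat)
    (I : smoothed_instance R n d) (p : 'I_n -> 'I_d -> R) : nat :=
  #|pareto_set (weight (knapsack I)) p (feasible (knapsack I))|.

(* f is Theta(g) uniformly on D (not only near infinity), for g >= 0 on D. *)
Definition is_Theta (R : realType) (U : Type) (D : set U) (f g : U -> R) :
    Prop :=
  exists a b : R, [/\ 0 < a, 0 < b &
    forall x, D x -> a * g x <= f x <= b * g x].

(* Main.v *)
(* Losses are measured from the profit of taking everything. Over objects of
   weights 1, 2, 4, ..., the heavier object j keeps every Pareto optimal set of
   its predecessors and adds itself to those of loss below p_j. For profits
   uniform on [0, 1/phi] the expected number of optimal sets of loss below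
   y / phi after j steps is 1 + j y, so a = n / 4 such objects give of order
   a^2 optimal sets. To stay within elementary probability, each profit range
   is cut into K = 4 a equal cells, and the recursion is run on cell indices,
   which only loses constant factors.

   Next come k objects whose profit exceeds the total profit so far; each of
   them doubles the number of optimal sets, and as its profit is known up to
   1/phi, the total before the i-th one stays below 2^i (a + 1) / phi. So
   2^k (a + 1) <= phi is affordable. Of the remaining objects, with
   profits in [1 - 1/phi, 1], one may take the first g v for v <= L; when g of
   them outweigh the total profit of the preceding objects, this gives L + 1
   copies. With k maximal, or k = 0 and g of order a / phi when phi <= a, one
   gets 2^k (L + 1) of order phi, unless k reaches n / 4. *)
Require Import Defs.
From HB Require Import structures.
From mathcomp Require Import all_boot all_order all_algebra.
From mathcomp Require Import all_classical all_reals all_analysis.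
From mathcomp Require Import measurable_realfun.
From mathcomp Require Import zify ring lra.

Set Implicit Arguments.
Unset Strict Implicit.
Unset Printing Implicit Defensive.

Import Order.TTheory GRing.Theory Num.Theory.
Import numFieldNormedType.Exports.

Local Open Scope classical_set_scope.
Local Open Scope ring_scope.

(** * Pareto optimal subsets of objects with exponential weights *)

(* If the j-th profit lies in the cell [c j, c j + 1[, then [small_losses c j y]
   and [front_size c j] bound from below the number of Pareto optimal subsets of
   the first j objects with loss below y, resp. of all of them. *)
Fixpoint small_losses (c : nat -> nat) (j y : nat) : nat :=
  if j is j'.+1 then
    small_losses c j' (minn (c j') y) + small_losses c j' (y - (c j').+1)
  else (0 < y)%N.

Fixpoint front_size (c : nat -> nat) (j : nat) : nat :=
  if j is j'.+1 then front_size c j' + small_losses c j' (c j') else 1.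

Lemma small_losses0 c j : small_losses c j 0 = 0%N.
Proof. by elim: j => //= j IH; rewrite minn0 sub0n IH. Qed.

Section Front.
Local Open Scope set_scope.
Context (R : realType) (n m : nat).

(** From index [m] on the weights stay at [2 ^+ m], so that each later object still outweighs the
    first [m] together. *)
Definition binary_weight (i : 'I_n) : R := 2 ^+ minn i m.

Definition prefix (j : nat) : {set 'I_n} := [set i : 'I_n | (i < j)%N]%SET.

Lemma prefixS (j : 'I_n) : prefix j.+1 = (j |: prefix j)%SET.
Proof. by apply/setP => i; rewrite !inE ltnS leq_eqVlt. Qed.

Lemma notin_prefix (j : 'I_n) : j \notin prefix j.
Proof. by rewrite inE ltnn. Qed.

Lemma subset_prefixS (s : {set 'I_n}) (j : 'I_n) :
  s \subset prefix j -> s \subset prefix j.+1.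
Proof.
by move=> ss; apply: (fintype.subset_trans ss); rewrite prefixS finset.subsetU1.
Qed.

Lemma subset_prefixP (s : {set 'I_n}) (j : 'I_n) :
  s \subset prefix j.+1 -> j \notin s -> s \subset prefix j.
Proof.
move=> /fintype.subsetP ss js; apply/fintype.subsetP => i si.
have := ss _ si; rewrite !inE ltnS leq_eqVlt => /orP[/eqP/val_inj ij|//].
by rewrite -ij si in js.
Qed.

Lemma total_weight_ge0 (s : {set 'I_n}) : 0 <= total_weight binary_weight s.
Proof. by apply: sumr_ge0 => i _; rewrite exprn_ge0. Qed.

Lemma total_weight_prefix j : (j <= m)%N ->
  total_weight binary_weight (prefix j) < 2 ^+ j.
Proof.
elim: j => [|j IH] jm.
  by rewrite /total_weight big_pred0 ?ltr01// => i; rewrite inE.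
have IHj := IH (ltnW jm).
have [jn|nj] := ltnP j n; last first.
  apply: (@le_lt_trans _ _ (total_weight binary_weight (prefix j))).
    rewrite le_eqVlt; apply/orP; left; apply/eqP; apply: eq_bigl => i.
    by rewrite !inE !(leq_trans (ltn_ord i))// leqW.
  by apply: (lt_trans IHj); rewrite exprS ltr_pMl ?exprn_gt0// ltr1n.
rewrite (prefixS (Ordinal jn)) /total_weight big_setU1 ?notin_prefix//=.
rewrite /binary_weight /= (minn_idPl (ltnW jm)) exprS.
rewrite /total_weight /binary_weight in IHj; lra.
Qed.

Lemma total_weightS (s s' : {set 'I_n}) : s \subset s' ->
  total_weight binary_weight s <= total_weight binary_weight s'.
Proof.
move=> ss'; rewrite /total_weight [leRHS](big_setID s)/= (finset.setIidPr ss').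
by rewrite lerDl total_weight_ge0.
Qed.

Variable p : 'I_n -> 'I_1 -> R.
Hypothesis p_ge0 : forall i j, 0 <= p i j.

Local Notation profit := (total_profit p ord0).
Local Notation wt := (total_weight binary_weight).

Lemma profitS (s s' : {set 'I_n}) : s \subset s' -> profit s <= profit s'.
Proof.
move=> ss'; rewrite /total_profit [leRHS](big_setID s)/= (finset.setIidPr ss').
by rewrite lerDl sumr_ge0.
Qed.

Lemma dominates1E (s' s : {set 'I_n}) : dominates binary_weight p s' s =
  [&& wt s' <= wt s, profit s <= profit s' &
      (wt s' < wt s) || (profit s < profit s')].
Proof.
rewrite /dominates; congr [&& _, _ & _ || _].
  by apply/forallP/idP => [/(_ ord0)//|h j]; rewrite (ord1 j).
by apply/existsP/idP => [[j]|h]; [rewrite (ord1 j)|exists ord0].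
Qed.

(** * Pareto optimal subsets of an initial segment *)

Definition front (j : nat) : {set {set 'I_n}} :=
  pareto_set binary_weight p (powerset (prefix j)).

Lemma frontP j (s : {set 'I_n}) : reflect
  (s \subset prefix j /\
   forall s' : {set 'I_n}, s' \subset prefix j -> ~~ dominates binary_weight p s' s)
  (s \in front j).
Proof.
rewrite !inE; apply: (iffP andP) => -[sj /= sP]; split => //.
  move=> s' s'j; have /forallP /(_ s') := sP.
  by rewrite powersetE s'j.
apply/forallP => s'; apply/implyP; rewrite powersetE; exact: sP.
Qed.

(** Every set containing [j] weighs more than all of [prefix j], hence dominates no subset of
    [prefix j]. *)
Lemma front_skip (j : 'I_n) (s : {set 'I_n}) :
  (j < m)%N -> s \in front j -> s \in front j.+1.
Proof.
move=> jm /frontP[sj sP]; apply/frontP; split; first exact: subset_prefixS.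
move=> s' s'j; have [js'|js'] := boolP (j \in s'); last first.
  exact/sP/subset_prefixP.
rewrite dominates1E; apply/negP => /and3P[ws's _ _].
have : wt s < wt s'.
  apply: (le_lt_trans (total_weightS sj)).
  apply: (lt_le_trans (total_weight_prefix (ltnW jm))).
  rewrite /total_weight (finset.big_setD1 j)//= /binary_weight.
  by rewrite (minn_idPl (ltnW jm)) lerDl; apply: sumr_ge0 => i _; rewrite exprn_ge0.
by rewrite ltNge ws's.
Qed.

(** A set without [j] has at most the profit of [prefix j], which is below that of [j |: s] by the
    loss condition. From a set with [j], remove [j] and compare with [s]. *)
Lemma front_add (j : 'I_n) (s : {set 'I_n}) : (j < m)%N -> s \in front j ->
  profit (prefix j) - profit s < p j ord0 -> (j |: s)%SET \in front j.+1.
Proof.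
move=> jm /frontP[sj sP] loss; apply/frontP; split.
  by rewrite prefixS finset.setUS.
move=> s' s'j.
have js : j \notin s by apply/negP => /(fintype.subsetP sj); rewrite inE ltnn.
have pj : profit (j |: s)%SET = p j ord0 + profit s.
  by rewrite /total_profit big_setU1.
have wj : wt (j |: s)%SET = binary_weight j + wt s.
  by rewrite /total_weight big_setU1.
have [js'|js'] := boolP (j \in s'); last first.
  rewrite dominates1E; apply/negP => /and3P[_ ps _].
  have := profitS (subset_prefixP s'j js'); rewrite pj in ps; lra.
have := sP (s' :\ j)%SET; rewrite !dominates1E pj wj.
have -> : profit s' = p j ord0 + profit (s' :\ j)%SET.
  by rewrite /total_profit (finset.big_setD1 j).
have -> : wt s' = binary_weight j + wt (s' :\ j)%SET.
  by rewrite /total_weight (finset.big_setD1 j).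
rewrite !lerD2l !ltrD2l; apply.
by rewrite finset.subDset -prefixS.
Qed.

Definition front_below (j : nat) (y : R) : {set {set 'I_n}} :=
  [set s in front j | profit (prefix j) - profit s < y]%SET.

(** Adding [j] keeps the loss of a set, skipping [j] raises it by [p j ord0]; the two families are
    disjoint, since only sets of the first contain [j]. *)
Lemma front_below_step (j : 'I_n) y : (j < m)%N ->
  (#|front_below j (Num.min (p j ord0) y)| + #|front_below j (y - p j ord0)|
   <= #|front_below j.+1 y|)%N.
Proof.
move=> jm.
have notj k s y' : s \in front_below k y' -> k = j -> j \notin s.
  move=> + kj; rewrite inE kj => /andP[/frontP[/fintype.subsetP sj _] _].
  by apply/negP => /sj; rewrite inE ltnn.
have pS : profit (prefix j.+1) = p j ord0 + profit (prefix j).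
  by rewrite prefixS /total_profit big_setU1 ?notin_prefix.
have injU : {in front_below j (Num.min (p j ord0) y) &,
    injective (fun s : {set 'I_n} => j |: s)%SET}.
  move=> s t sj tj /setP st; apply/setP => i.
  have [->|ij] := eqVneq i j.
    by rewrite (negbTE (notj _ _ _ sj erefl)) (negbTE (notj _ _ _ tj erefl)).
  by have := st i; rewrite !inE (negbTE ij).
rewrite -(card_in_imset injU) -cardsUI; set U := imset _ _.
have -> : (U :&: front_below j (y - p j ord0) = finset.set0)%SET.
  apply/setP => s; rewrite [RHS]inE inE; apply/negP => /andP[/imsetP[t _ ->]].
  by move=> /notj /(_ erefl); rewrite !inE eqxx.
rewrite cards0 addn0.
apply: subset_leq_card; apply/fintype.subsetP => s /finset.setUP[/imsetP[t tj ->]|sj].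
  have jt := notj _ _ _ tj erefl.
  move: tj; rewrite inE lt_min => /and3P[tj lp ly].
  rewrite inE front_add//= pS /total_profit big_setU1//=.
  rewrite -/(profit t) -/(profit (prefix j)); lra.
move: sj; rewrite inE => /andP[sj ly]; rewrite inE front_skip//= pS; lra.
Qed.

Lemma front_below_le j y y' : y <= y' -> (#|front_below j y| <= #|front_below j y'|)%N.
Proof.
move=> yy'; apply: subset_leq_card; apply/fintype.subsetP => s; rewrite !inE.
by move=> /andP[->] /= h; apply: (lt_le_trans h).
Qed.

Lemma front_below_all j y : profit (prefix j) < y -> front_below j y = front j.
Proof.
move=> py; apply/setP => s; rewrite inE andb_idr// => _.
apply: le_lt_trans py; rewrite lerBlDr lerDl; exact: sumr_ge0.
Qed.

Lemma card_front_step (j : 'I_n) : (j < m)%N ->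
  (#|front j| + #|front_below j (p j ord0)| <= #|front j.+1|)%N.
Proof.
move=> jm; have pS : profit (prefix j.+1) = p j ord0 + profit (prefix j).
  by rewrite prefixS /total_profit big_setU1 ?notin_prefix.
have P0 : 0 <= profit (prefix j) by apply: sumr_ge0.
(* A threshold above every possible loss turns the counts into those of whole fronts. *)
have := @front_below_step j (profit (prefix j.+1) + 1) jm.
rewrite (@front_below_all j.+1) ?ltrDl//.
rewrite (@front_below_all j (_ - _)); last by rewrite pS; lra.
by rewrite addnC (min_idPl _)// pS; lra.
Qed.

Lemma card_front_double (j : 'I_n) : (j < m)%N -> profit (prefix j) < p j ord0 ->
  (2 * #|front j| <= #|front j.+1|)%N.
Proof.
move=> jm pj; have := card_front_step jm; rewrite front_below_all//; lia.
Qed.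

Lemma front0 : (0 < #|front 0|)%N.
Proof.
apply/card_gt0P; exists finset.set0; apply/frontP; split; first exact: finset.sub0set.
move=> s; have -> : prefix 0 = finset.set0 by apply/setP => i; rewrite !inE.
by rewrite finset.subset0 => /eqP ->; rewrite dominates1E ltxx ltxx !andbF.
Qed.

(** The lower end of the cell of [p j] bounds the sets to which [j] can be added, its upper end
    bounds the loss caused by skipping [j]. *)
Lemma front_below_box (c : nat -> nat) (e : R) (a : nat) :
  0 < e -> (a <= m)%N -> (a <= n)%N ->
  (forall i : 'I_n, (i < a)%N -> (c i)%:R * e <= p i ord0 < (c i).+1%:R * e) ->
  forall j, (j <= a)%N ->
  (forall y, small_losses c j y <= #|front_below j (y%:R * e)|)%N /\
  (front_size c j <= #|front j|)%N.
Proof.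
move=> e0 am an cp; elim=> [_|j IH ja].
  split; last exact: front0.
  case=> //= y; rewrite front_below_all ?front0//.
  rewrite /total_profit big_pred0; last by move=> i; rewrite inE.
  by rewrite mulr_gt0.
have [IHb IHs] := IH (ltnW ja).
have jn := leq_trans ja an; pose J := Ordinal jn.
have /andP[cl cu] := cp J ja.
split => [y|]; last first.
  apply: leq_trans (@card_front_step J (leq_trans ja am)) => /=.
  by rewrite leq_add// (leq_trans (IHb _))// front_below_le.
apply: leq_trans (@front_below_step J (y%:R * e) (leq_trans ja am)) => /=.
apply: leq_add.
  apply: leq_trans (IHb _) _; apply: front_below_le; rewrite le_min.
  apply/andP; split.
    by apply: le_trans cl; rewrite ler_pM2r// ler_nat geq_minl.
  by rewrite ler_pM2r// ler_nat geq_minr.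
(* For [y <= c j] the truncated difference is 0 and nothing is counted. *)
have [yc|cy] := leqP y (c j).
  by rewrite (eqP (leqW yc : (y - (c j).+1 == 0)%N)) small_losses0.
apply: leq_trans (IHb _) _; apply: front_below_le.
by rewrite natrB// mulrBl lerB// ltW.
Qed.


(** The bound on the total before the [i]-th of these objects is exactly the lower end of its profit
    range, so the object doubles the front. Adding the upper end of that range gives the bound for
    [i.+1]. *)
Lemma card_front_doubling (e : R) (a k : nat) :
  0 <= e -> (0 < a)%N -> (a + k <= m)%N -> (a + k <= n)%N ->
  (forall i : 'I_n, (i < a)%N -> p i ord0 < e) ->
  (forall i : 'I_n, (a <= i < a + k)%N ->
     (2 ^+ (i - a) * a.+1%:R - 1) * e <= p i ord0 < 2 ^+ (i - a) * a.+1%:R * e) ->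
  forall i, (i <= k)%N ->
  profit (prefix (a + i)) < (2 ^+ i * a.+1%:R - 1) * e /\
  (2 ^ i * #|front a| <= #|front (a + i)|)%N.
Proof.
move=> e0 a0 akm akn pa pk.
have base j : (j < a)%N -> profit (prefix j.+1) < j.+1%:R * e.
  elim: j => [|j IH] ja.
    have n0 : (0 < n)%N by lia.
    rewrite (prefixS (Ordinal n0)) /total_profit big_setU1 ?notin_prefix//=.
    by rewrite big_pred0 => [|i]; rewrite ?inE// addr0 mul1r pa.
  have jn : (j.+1 < n)%N by lia.
  have := IH (ltnW ja).
  rewrite (prefixS (Ordinal jn)) /total_profit big_setU1 ?notin_prefix//=.
  rewrite -[j.+2]addn1 natrD mulrDl mul1r addrC => IHj.
  by rewrite ltrD// pa.
elim=> [_|i IH ik].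
  rewrite addn0 expr0 mul1n; split=> //.
  by rewrite mul1r -natr1 addrK -(prednK a0) base// prednK.
have [IHp IHc] := IH (ltnW ik).
have jn : (a + i < n)%N by lia.
pose J := Ordinal jn.
have /andP[] := pk J ltac:(rewrite /=; lia); rewrite /= addKn => pl pu.
split.
  rewrite addnS (prefixS J) /total_profit big_setU1 ?notin_prefix//=.
  rewrite -/(profit (prefix (a + i))) exprS.
  by move: IHp pu; set z := _ * a.+1%:R; rewrite -mulrA -/z; lra.
rewrite addnS expnS -mulnA.
apply: leq_trans (@card_front_double J _ _); last 2 first.
- by rewrite /=; lia.
- exact: lt_le_trans pl.
by rewrite leq_mul2l IHc.
Qed.

(** * Copies of the front by blocks of heavy objects *)

Lemma card_prefix j : (j <= n)%N -> #|prefix j| = j.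
Proof.
move=> jn; rewrite -sum1_card; under eq_bigl do rewrite inE.
by rewrite -(big_ord_widen _ (fun=> 1%N) jn) sum_nat_const card_ord muln1.
Qed.

Lemma leq_prefix i j : (i <= j)%N -> prefix i \subset prefix j.
Proof.
by move=> ij; apply/fintype.subsetP => x; rewrite !inE => /leq_trans; exact.
Qed.

Definition block (g v : nat) : {set 'I_n} :=
  (prefix (m + g * v) :\: prefix m)%SET.

(* The objects from [m] on may only be taken as one of the initial [block]s; those
   beyond [block g L] are never taken. *)
Definition prefix_or_blocks (g L : nat) : {set {set 'I_n}} :=
  [set s : {set 'I_n} | [exists v : 'I_L.+1, s :\: prefix m == block g v]]%SET.

Lemma block_gap (g v v' : nat) (F : 'I_n -> R) (b : R) :
  (forall i : 'I_n, (m <= i)%N -> b <= F i) -> 0 <= b ->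
  (v < v')%N -> (m + g * v' <= n)%N ->
  \sum_(i in block g v) F i + g%:R * b <= \sum_(i in block g v') F i.
Proof.
move=> Fb b0 vv' mn.
have gvv' : (g * v <= g * v')%N by rewrite leq_mul2l (ltnW vv') orbT.
rewrite [leRHS](big_setID (block g v))/= (finset.setIidPr _); last first.
  by apply: finset.setSD; apply: leq_prefix; lia.
rewrite lerD2l.
have -> : (block g v' :\: block g v = prefix (m + g * v') :\: prefix (m + g * v))%SET.
  by apply/setP => i; rewrite !inE; lia.
apply: (@le_trans _ _ (\sum_(i in (prefix (m + g * v') :\: prefix (m + g * v))%SET) b)).
  rewrite sumr_const cardsD (finset.setIidPr _); last by apply: leq_prefix; lia.
  rewrite !card_prefix; [|lia|lia].
  rewrite -[leRHS]mulr_natl ler_wpM2r// ler_nat.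
  have : (g * v.+1 <= g * v')%N by rewrite leq_mul2l vv' orbT.
  by rewrite mulnS; lia.
by apply: ler_sum => i; rewrite !inE => /andP[]; rewrite -leqNgt => h _; apply: Fb; lia.
Qed.

(** Passing to a longer block costs more weight and brings more profit than all of [prefix m] can
    offset, so solutions with different blocks never dominate each other; with equal blocks,
    domination is that of the parts in [prefix m]. For [L = 0] there is only one block and no gap to
    secure. *)
Lemma card_pareto_copies (g L : nat) (b : R) :
  (0 < g)%N -> (m + g * L <= n)%N -> 0 <= b ->
  (forall i : 'I_n, (m <= i)%N -> b <= p i ord0) ->
  ((0 < L)%N -> profit (prefix m) < g%:R * b) ->
  (L.+1 * #|front m| <= #|pareto_set binary_weight p (prefix_or_blocks g L)|)%N.
Proof.
move=> g0 mn b0 pb gap.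
have mn' (v : 'I_L.+1) : (m + g * v <= n)%N.
  by apply: leq_trans mn; rewrite leq_add2l leq_mul2l -ltnS ltn_ord orbT.
have dis (s : {set 'I_n}) v (F : 'I_n -> R) : s \subset prefix m ->
    \sum_(i in s :|: block g v) F i = \sum_(i in s) F i + \sum_(i in block g v) F i.
  move=> sm; rewrite -bigU/=; last rewrite disjoint_subset; last first.
    by apply/fintype.subsetP => i /(fintype.subsetP sm); rewrite !inE => ->.
  by apply: eq_bigl => i; rewrite inE.
have wgap (v v' : 'I_L.+1) : (v < v')%N ->
    wt (block g v) + 2 ^+ m <= wt (block g v').
  move=> vv'; apply: (@le_trans _ _ (wt (block g v) + g%:R * 2 ^+ m)).
    by rewrite lerD2l ler_peMl ?exprn_ge0// ler1n.
  apply: block_gap => //; rewrite ?exprn_ge0// => i mi.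
  by rewrite /binary_weight (minn_idPr mi).
have pgap (v v' : 'I_L.+1) : (v < v')%N ->
    profit (block g v) + profit (prefix m) < profit (block g v').
  move=> vv'; have := @block_gap g v v' (p^~ ord0) b pb b0 vv' (mn' v').
  apply: lt_le_trans; rewrite ltrD2l gap//.
  by have := ltn_ord v'; lia.
have wm : wt (prefix m) < 2 ^+ m by exact: total_weight_prefix.
have capE (s : {set 'I_n}) v : s \subset prefix m ->
    ((s :|: block g v) :&: prefix m = s)%SET.
  move=> sm; apply/setP => i; rewrite !inE.
  by have := fintype.subsetP sm i; rewrite inE; case: (i \in s) => [->//|_] /=; lia.
have capD (s : {set 'I_n}) v : s \subset prefix m ->
    ((s :|: block g v) :\: prefix m = block g v)%SET.
  move=> sm; apply/setP => i; rewrite !inE.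
  by have := fintype.subsetP sm i; rewrite inE; case: (i \in s) => [->//|_] /=; lia.
pose D := finset.setX [set: 'I_L.+1]%SET (front m).
have <- : #|D| = (L.+1 * #|front m|)%N by rewrite cardsX cardsT card_ord.
pose f (vs : 'I_L.+1 * {set 'I_n}) := (vs.2 :|: block g vs.1)%SET.
have injf : {in D &, injective f}.
  move=> [v s] [v' s']; rewrite !finset.in_setX !finset.in_setT /=.
  move=> /frontP[sm _] /frontP[s'm _].
  rewrite /f/= => ss'; congr pair; last by rewrite -(capE s v) // ss' capE.
  have bv : block g v = block g v' by rewrite -(capD s v)// ss' capD.
  (* Distinct blocks differ because their weights do. *)
  apply/val_inj; have [vv'|vv'|//] := ltngtP v v'.
    have := wgap _ _ vv'; rewrite bv.
    by rewrite gerDl leNgt exprn_gt0.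
  have := wgap _ _ vv'; rewrite bv.
  by rewrite gerDl leNgt exprn_gt0.
rewrite -(card_in_imset injf); apply: subset_leq_card.
apply/fintype.subsetP => _ /imsetP[[v s] + ->].
rewrite /f finset.in_setX finset.in_setT/= => /frontP[sm sP].
rewrite !inE.
apply/andP; split; first by apply/existsP; exists v; rewrite capD.
apply/forallP => t; apply/implyP; rewrite inE => /existsP[v' /eqP tv'].
have := finset.subsetIr t (prefix m); set s' := (t :&: prefix m)%SET => s'm.
have -> : t = (s' :|: block g v')%SET by rewrite -tv' finset.setID.
rewrite dominates1E /total_weight /total_profit !dis//.
have := sP _ s'm; rewrite dominates1E /total_weight /total_profit.
have [vv'|vv'|vv'] := ltngtP v v'.
- move=> _; apply/negP => /and3P[h _ _].
  have := wgap _ _ vv'; have := total_weightS sm; have := total_weight_ge0 s'.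
  rewrite /total_weight in h wm *; lra.
- move=> _; apply/negP => /and3P[_ h _].
  have := pgap _ _ vv'; have := profitS s'm.
  have : 0 <= profit s by exact: sumr_ge0.
  rewrite /total_profit in h *; lra.
- by rewrite (val_inj vv') !lerD2r !ltrD2r.
Qed.

End Front.

(** * Averages over the cells *)

Section Average.
Context (R : realType) (n K : nat).

Local Notation cells := {ffun 'I_n -> 'I_K}.

Definition cell_seq (kap : cells) (i : nat) : nat :=
  if insub i is Some i' then kap i' else 0%N.

Lemma cell_seqE (kap : cells) (i : 'I_n) : cell_seq kap i = kap i.
Proof. by rewrite /cell_seq valK. Qed.

Definition resample (kap : cells) (j : 'I_n) (k : 'I_K) : cells :=
  [ffun i => if i == j then k else kap i].

(* The left side counts pairs (kap, k); exchanging k with kap j permutes them. *)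
Lemma sum_resample (j : 'I_n) (F : cells -> R) :
  \sum_kap \sum_(k < K) F (resample kap j k) = K%:R * \sum_kap F kap.
Proof.
pose h (x : cells * 'I_K) := (resample x.1 j x.2, x.1 j).
have hK : involutive h.
  move=> [kap k]; rewrite /h /=; congr pair; last by rewrite ffunE eqxx.
  by apply/ffunP => i; rewrite !ffunE; case: eqP => [->|].
rewrite pair_big (reindex_inj (inv_inj hK))/=.
rewrite (eq_bigr (fun x => F x.1)) => [|[kap k] _]; last first.
  congr F; apply/ffunP => i; rewrite !ffunE.
  by case: eqP => [->|].
rewrite -(pair_big xpredT xpredT (fun kap (_ : 'I_K) => F kap))/= mulr_sumr.
by apply: eq_bigr => kap _; rewrite sumr_const card_ord mulr_natl.
Qed.

Lemma eq_small_losses (c c' : nat -> nat) j y :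
  (forall i, (i < j)%N -> c i = c' i) -> small_losses c j y = small_losses c' j y.
Proof.
elim: j y => //= j IH y cc'; rewrite cc' ?ltnSn//.
by rewrite !IH// => i ij; apply: cc'; rewrite ltnS ltnW.
Qed.

Lemma cell_seq_resample (kap : cells) (j : 'I_n) k i : (i < j)%N ->
  cell_seq (resample kap j k) i = cell_seq kap i.
Proof.
move=> ij; have iN : (i < n)%N by apply: ltn_trans (ltn_ord j).
rewrite -[i]/(val (Ordinal iN)) !cell_seqE ffunE; case: eqP => // e.
by rewrite -e /= ltnn in ij.
Qed.

Definition sum_losses (j y : nat) : R :=
  \sum_(kap : cells) (small_losses (cell_seq kap) j y)%:R.

Definition sum_front (j : nat) : R :=
  \sum_(kap : cells) (front_size (cell_seq kap) j)%:R.

(** [small_losses c j] reads only the cells below [j], so the cell of [j] can be averaged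
    separately. *)
Lemma sum_lossesS j y : (j < n)%N ->
  K%:R * sum_losses j.+1 y =
  \sum_(k < K) (sum_losses j (minn k y) + sum_losses j (y - k.+1)).
Proof.
move=> jn; pose J := Ordinal jn; rewrite -(sum_resample J) exchange_big /=.
apply: eq_bigr => k _; rewrite -big_split/=; apply: eq_bigr => kap _.
have -> : cell_seq (resample kap J k) j = k.
  by rewrite -[j]/(val J) cell_seqE ffunE eqxx.
by rewrite natrD; congr (_%:R + _%:R); apply: eq_small_losses => i ij;
  rewrite (@cell_seq_resample _ J).
Qed.

Lemma sum_frontS j : (j < n)%N ->
  K%:R * sum_front j.+1 = K%:R * sum_front j + \sum_(k < K) sum_losses j k.
Proof.
move=> jn; pose J := Ordinal jn.
rewrite -!(sum_resample J) [X in _ + X]exchange_big -big_split /=.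
apply: eq_bigr => kap _; rewrite -big_split/=; apply: eq_bigr => k _.
have -> : cell_seq (resample kap J k) j = k.
  by rewrite -[j]/(val J) cell_seqE ffunE eqxx.
rewrite natrD; congr (_ + _%:R); apply: eq_small_losses => i ij.
by rewrite (@cell_seq_resample _ J).
Qed.

(** * Quadratic growth of the average front *)

(** The value at 0 is treated apart because [sum_losses j 0] is 0, below the affine bound used for
    positive thresholds. *)
Lemma sum_affine (G : nat -> R) (A B : R) y :
  0 <= G 0%N -> (forall k, (0 < k <= y)%N -> A + B * k%:R <= G k) ->
  A * y%:R + B * (y%:R * y.+1%:R / 2) <= \sum_(k < y.+1) G k.
Proof.
move=> G0; elim: y => [|y IH] GAB.
  by rewrite big_ord_recr big_ord0/= !mul0r !mulr0 !addr0 add0r.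
rewrite big_ord_recr/=.
have := GAB y.+1; rewrite leqnn/= => /(_ isT) Gy.
have /IH : forall k, (0 < k <= y)%N -> A + B * k%:R <= G k.
  by move=> k ky; apply: GAB; lia.
move: Gy; rewrite -[y.+2]addn1 -[y.+1]addn1 !natrD; set s := \sum_(_ < _) _.
by move: (y%:R : R) => Y; lra.
Qed.

(** For [k < y] both arguments run through all values below [y], one upwards and one downwards; for
    [k >= y] they are [y] and 0. *)
Lemma sum_split_min (G : nat -> R) y : 0 <= G 0%N -> (y <= K)%N ->
  (K - y)%:R * G y + 2 * \sum_(k < y) G k <=
  \sum_(k < K) (G (minn k y) + G (y - k.+1)%N).
Proof.
move=> G0 yK; rewrite -(big_mkord xpredT (fun k => G (minn k y) + G (y - k.+1)%N)).
rewrite (@big_cat_nat _ _ _ y)//= addrC; apply: lerD.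
  rewrite [leLHS](_ : _ = \sum_(y <= k < K) G y); last first.
    by rewrite sumr_const_nat mulr_natl.
  rewrite !big_nat; apply: ler_sum => k /andP[yk _].
  by rewrite (minn_idPr yk) (eqP (_ : y - k.+1 == 0)%N) ?lerDl//; lia.
rewrite big_mkord big_split/= mulr_natl mulr2n.
rewrite [X in _ <= _ + X](reindex_inj rev_ord_inj)/=.
rewrite le_eqVlt; apply/orP; left; apply/eqP; congr (_ + _); apply: eq_bigr => k _.
  by rewrite (minn_idPl (ltnW (ltn_ord k))).
by congr G; have := ltn_ord k; lia.
Qed.

Variable a : nat.
Hypothesis a_gt0 : (0 < a)%N.
Hypothesis an : (a <= n)%N.
Hypothesis Ka : K = (4 * a)%N.

(** Discrete form of the mean [1 + j y], with [y / K] for [y]. Each step of the bound raises the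
    slope by [1 / (4 K)] and lowers the intercept by [2 / K]; the intercept stays at least 1/2
    because [K = 4 a]. *)
Lemma sum_losses_ge j y : (j <= a)%N -> (0 < y <= K)%N ->
  #|cells|%:R * (1 - 2 * j%:R / K%:R + j%:R / (4 * K%:R) * y%:R) <= sum_losses j y.
Proof.
have K0 : (0 : R) < K%:R by rewrite ltr0n; lia.
elim: j y => [|j IH] y ja /andP[y0 yK].
  rewrite mulr0 !mul0r subr0 addr0 mulr1 /sum_losses /= y0.
  by rewrite sumr_const.
have {}IH := IH _ (ltnW ja).
set V : R := #|_|%:R in IH *.
have V0 : 0 <= V by rewrite ler0n.
pose A : R := 1 - 2 * j%:R / K%:R; pose B : R := j%:R / (4 * K%:R).
rewrite -(ler_pM2l K0) sum_lossesS; last by lia.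
have L0 : 0 <= sum_losses j 0 by apply: sumr_ge0 => kap _; rewrite ler0n.
apply: le_trans (sum_split_min L0 yK); rewrite natrB//.
have := @sum_affine (sum_losses j) (V * A) (V * B) y.-1 L0 _.
rewrite prednK// => /(_ _)/le_trans h.
have {h} hsum :
  V * A * y.-1%:R + V * B * (y.-1%:R * y%:R / 2) <= \sum_(k < y) sum_losses j k.
  apply: h => // k ky; apply: le_trans (IH k _); last by lia.
  by rewrite -[V * B * _]mulrA -mulrDr.
have hy := IH y ltac:(lia); rewrite -/A -/B in hy.
have yKR : y%:R <= K%:R :> R by rewrite ler_nat.
have hy' : (K%:R - y%:R) * (V * (A + B * y%:R)) <= (K%:R - y%:R) * sum_losses j y.
  by rewrite ler_wpM2l// subr_ge0.
have y1 : y.-1%:R = y%:R - 1 :> R by rewrite -{2}(prednK y0) -natr1 addrK.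
rewrite y1 in hsum.
have AK : A * K%:R = K%:R - 2 * j%:R by rewrite /A; field; rewrite gt_eqF.
have BK : B * K%:R = j%:R / 4 by rewrite /B; field; rewrite gt_eqF.
have jK : 4 * j%:R <= K%:R :> R by rewrite -natrM ler_nat; lia.
have A1 : A <= 1 by rewrite /A gerBl divr_ge0// mulr_ge0.
have A2 : 1/2 <= A by rewrite -(ler_pM2r K0) AK; lra.
have B1 : B <= 1/16 by rewrite -(ler_pM2r K0) BK; lra.
have -> : K%:R * (V * (1 - 2 * j.+1%:R / K%:R + j.+1%:R / (4 * K%:R) * y%:R)) =
  V * (K%:R * A + K%:R * B * y%:R - 2 + y%:R / 4).
  by rewrite /A /B -natr1; field; rewrite gt_eqF.
apply: le_trans (lerD hy' (ler_wpM2l _ hsum)); last by [].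
(* The terms quadratic in [y] cancel, and the slack is nonnegative since [A <= 1] and
   [A - B >= 1/2 - 1/16]. *)
rewrite -subr_ge0; set D := (X in 0 <= X).
have -> : D = V * (2 * (1 - A) + (A - B - 1/4) * y%:R) by rewrite /D; field.
apply: mulr_ge0 => //; apply: addr_ge0; first lra.
by apply: mulr_ge0 => //; lra.
Qed.

Lemma sum_front_ge : #|cells|%:R * (a%:R ^+ 2 / 32) <= sum_front a.
Proof.
have K0 : (0 : R) < K%:R by rewrite ltr0n; lia.
(* With 3/64 the induction closes: multiplied by [K], the gain per step has [j]-coefficient
   [(K - 1) / 8], which is at least [2 * (3 / 64) * K] as [K >= 4]. *)
suff H j : (j <= a)%N -> #|cells|%:R * (3 / 64 * j%:R ^+ 2) <= sum_front j.
  apply: le_trans (H a _) => //; rewrite ler_wpM2l ?ler0n//.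
  have := sqr_ge0 (a%:R : R); lra.
elim: j => [_|j IH ja].
  by rewrite expr0n/= !mulr0; apply: sumr_ge0 => kap _; rewrite ler0n.
have {}IH := IH (ltnW ja); have hl y := @sum_losses_ge j y (ltnW ja).
set V : R := #|_|%:R in IH hl *.
have V0 : 0 <= V by rewrite ler0n.
pose A : R := 1 - 2 * j%:R / K%:R; pose B : R := j%:R / (4 * K%:R).
rewrite -(ler_pM2l K0) sum_frontS; last by lia.
have L0 : 0 <= sum_losses j 0 by apply: sumr_ge0 => kap _; rewrite ler0n.
have := @sum_affine (sum_losses j) (V * A) (V * B) K.-1 L0 _.
rewrite prednK; last by lia.
move=> /(_ _)/le_trans h.
have {h} hsum :
  V * A * K.-1%:R + V * B * (K.-1%:R * K%:R / 2) <= \sum_(k < K) sum_losses j k.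
  apply: h => // k ky; apply: le_trans (hl k _); last by lia.
  by rewrite -[V * B * _]mulrA -mulrDr.
have K1 : K.-1%:R = K%:R - 1 :> R.
  by rewrite -{2}(prednK (_ : 0 < K)%N) -?natr1 ?addrK//; lia.
rewrite K1 in hsum.
have AK : A * K%:R = K%:R - 2 * j%:R by rewrite /A; field; rewrite gt_eqF.
have BK : B * K%:R = j%:R / 4 by rewrite /B; field; rewrite gt_eqF.
have jK : 4 * j%:R <= K%:R :> R by rewrite -natrM ler_nat; lia.
have K4 : 4 <= K%:R :> R by rewrite ler_nat; lia.
have A2 : 1/2 <= A by rewrite -(ler_pM2r K0) AK; lra.
apply: le_trans (lerD (ler_wpM2l (ltW K0) IH) hsum).
have -> : V * A * (K%:R - 1) + V * B * ((K%:R - 1) * K%:R / 2) =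
  V * (A * (K%:R - 1) + j%:R / 8 * (K%:R - 1)).
  by have -> : j%:R / 8 = B * K%:R / 2 :> R; [rewrite BK; field|field].
rewrite mulrCA [K%:R * (V * _)]mulrCA -mulrDr ler_wpM2l// -natr1.
have : 1 / 2 * (K%:R - 1) <= A * (K%:R - 1) by rewrite ler_wpM2r//; lra.
have j0 : 0 <= j%:R :> R by rewrite ler0n.
have : 0 <= j%:R * (K%:R - 4) :> R by rewrite mulr_ge0// subr_ge0.
by move: (A * _) => z; nra.
Qed.

End Average.

(** * Uniform profits *)

(* No measurability is assumed: the integral of a nonnegative function is a
   supremum over the simple functions below it. *)
Lemma ge0_le_integral_nonmeasurable (R : realType) (d : measure_display)
    (T : measurableType d) (mu : {measure set T -> \bar R}) (f g : T -> \bar R) :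
  (forall x, 0 <= f x)%E -> (forall x, f x <= g x)%E ->
  (\int[mu]_x f x <= \int[mu]_x g x)%E.
Proof.
move=> f0 fg; have g0 x : (0 <= g x)%E by apply: le_trans (fg x).
rewrite !ge0_integralTE//; apply: ereal_sup_le => _ [h /= hf <-].
by exists h => //= x; apply: le_trans (fg x).
Qed.

(** The events are disjoint, so [Y] lies above the simple function equal to [v j] on [B j] and 0
    elsewhere, whose integral is the left side. *)
Lemma expectation_ge (R : realType) (d : measure_display)
    (T : measurableType d) (P : probability T R) (J : finType)
    (B : J -> set T) (v : J -> R) (q : R) (Y : T -> R) :
  (forall j, measurable (B j)) -> (forall j, P (B j) = q%:E) ->
  (forall i j t, B i t -> B j t -> i = j) ->
  (forall j, 0 <= v j) -> (forall t, 0 <= Y t) ->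
  (forall j t, B j t -> v j <= Y t) ->
  ((q * \sum_j v j)%:E <= 'E_P[Y])%E.
Proof.
move=> mB PB Binj v0 Y0 vY.
rewrite expectation.unlock.
apply: (@le_trans _ _ (\int[P]_t \sum_(j : J) (v j * \1_(B j) t)%:E)%E).
  rewrite ge0_integral_sum//; first last.
  - by move=> j t _; rewrite lee_fin mulr_ge0.
  - by move=> j; apply/measurable_EFinP; apply: measurable_funM.
  rewrite mulr_sumr -sumEFin le_eqVlt; apply/orP; left; apply/eqP.
  apply: eq_bigr => j _.
  rewrite (@integralZl_indic _ _ _ _ _ _ (fun=> B j))//; last first.
    by move=> vj; have := v0 j; rewrite leNgt vj.
  by rewrite integral_indic// setIT [X in (_ * X)%E](PB j) -EFinM mulrC.
apply: ge0_le_integral_nonmeasurable => t; rewrite sumEFin lee_fin.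
  by apply: sumr_ge0 => j _; rewrite mulr_ge0.
have [[j Bj]|nB] := pselect (exists j, B j t).
  rewrite (bigD1 j)//= big1 ?addr0 => [|i ij].
    by rewrite indicE mem_set// mulr1 vY.
  rewrite indicE memNset ?mulr0// => Bi.
  by rewrite (Binj _ _ _ Bi Bj) eqxx in ij.
rewrite big1// => j _; rewrite indicE memNset ?mulr0// => Bj.
by apply: nB; exists j.
Qed.

Section Uniform.
Context (R : realType) (phi h : R).
Hypothesis phi1 : 1 <= phi.
Hypothesis h_le1 : h <= 1.
Hypothesis h_ge : phi^-1 <= h.

Definition uniform_density (x : R) : R := phi * \1_(`[h - phi^-1, h]) x.

Let phi_gt0 : 0 < phi. Proof. exact: lt_le_trans phi1. Qed.

Let support_sub : `[h - phi^-1, h] `<=` `[(-1)%R : R, 1%R].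
Proof.
move=> x /=; rewrite !in_itv/= => /andP[hx xh].
apply/andP; split; last exact: le_trans h_le1.
by apply: le_trans hx; rewrite (@le_trans _ _ 0) ?lerN10 ?subr_ge0.
Qed.

Let uniform_integral (A : set R) : measurable A ->
  (\int[lebesgue_measure]_(x in A `&` `[(-1)%R : R, 1%R]) (uniform_density x)%:E
   = phi%:E * lebesgue_measure (`[(h - phi^-1)%R, h] `&` A))%E.
Proof.
move=> mA; rewrite /uniform_density.
have mD : measurable (A `&` `[(-1)%R : R, 1%R]) by exact: measurableI.
have -> := @integralZl_indic _ _ R lebesgue_measure _ mD
  (fun=> `[h - phi^-1, h]%classic) phi.
- rewrite integral_indic//.
  by congr (_ * lebesgue_measure _)%E; rewrite setICA (setIidl support_sub) setIC.
- by move=> /(lt_trans phi_gt0); rewrite ltxx.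
- exact: measurable_itv.
Qed.

Lemma uniform_density_wf : is_density uniform_density.
Proof.
split.
- exact: measurable_funM.
- by move=> x _; apply: mulr_ge0; first exact: ltW.
- rewrite -[X in (\int[_]_(x in X) _)%E](setTI) uniform_integral// setIT.
  rewrite lebesgue_measure_itv/= lte_fin ltrBlDr ltrDl invr_gt0 phi_gt0.
  by rewrite -EFinB -EFinM subKr divff// gt_eqF.
Qed.

Lemma uniform_density_le x : uniform_density x <= phi.
Proof.
by rewrite /uniform_density ler_piMr ?(ltW phi_gt0).
Qed.

Lemma uniform_probability (d : measure_display) (T : measurableType d)
    (P : probability T R) (X : {RV P >-> R}) (x y : R) :
  has_density X uniform_density -> h - phi^-1 <= x -> x < y -> y <= h ->
  P (X @^-1` `[x, y[) = (phi * (y - x))%:E.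
Proof.
move=> dX hx xy yh; have := dX `[x, y[%classic (measurable_itv _).
rewrite uniform_integral// => dXA.
rewrite -[LHS]/(distribution P X `[x, y[%classic) dXA.
rewrite setIidr ?lebesgue_measure_itv/= ?lte_fin ?xy -?EFinB//.
move=> z /=; rewrite !in_itv/= => /andP[xz zy]; apply/andP; split.
  exact: le_trans xz.
exact: le_trans (ltW zy) yh.
Qed.

End Uniform.

(** * The instance *)

Section Instance.
Context (R : realType) (n : nat).

(* A single group; removing [set0] only matters for [n = 0]. *)
Definition one_group : {set {set 'I_n}} :=
  ([set [set: 'I_n]] :\ finset.set0)%SET.

Lemma one_group_wf : finset.partition one_group [set: 'I_n]%SET.
Proof.
have cov : finset.cover one_group = [set: 'I_n]%SET.
  apply/setP => i; rewrite inE; apply/bigcupP; exists [set: 'I_n]%SET => //.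
  by rewrite !inE eqxx andbT; apply/finset.set0Pn; exists i.
rewrite /finset.partition cov eqxx /= !inE eqxx /= andbT; apply/finset.trivIsetP.
by move=> A B; rewrite !inE => /andP[_ /eqP ->] /andP[_ /eqP ->] /eqP.
Qed.

Lemma one_group_choices_wf (S : {set {set 'I_n}}) G :
  G \in one_group -> (S :&: powerset G)%SET \subset powerset G.
Proof. by move=> _; exact: finset.subsetIr. Qed.

Definition one_group_knapsack (w : 'I_n -> R) (S : {set {set 'I_n}}) :=
  GroupKnapsack w one_group_wf (@one_group_choices_wf S).

(** For [n = 0] there is no group and every set is feasible, hence [0 < n]. *)
Lemma feasible_one_group w S : (0 < n)%N ->
  feasible (one_group_knapsack w S) = S.
Proof.
move=> n0; have T0 : [set: 'I_n]%SET != finset.set0.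
  by apply/finset.set0Pn; exists (Ordinal n0).
apply/setP => s; rewrite inE; apply/forallP/idP => [/(_ [set: 'I_n]%SET)|sS G].
  by rewrite /= !inE eqxx T0 finset.setIT finset.subsetT /= andbT.
apply/implyP; rewrite /= !inE => /andP[_ /eqP ->].
by rewrite finset.setIT sS finset.subsetT.
Qed.

Context (a k g L : nat) (phi : R).
Hypothesis phi1 : 1 <= phi.

Let m := (a + k)%N.

(** Right end of the support of the [i]-th density. The minimum with 1 makes the densities well
    formed before [doubling_le] is assumed. *)
Definition max_profit (i : 'I_n) : R :=
  Num.min 1 ((if (i < a)%N then 1 else
              if (i < m)%N then 2 ^+ (i - a) * a.+1%:R else phi) / phi).

Let phi_gt0 : 0 < phi. Proof. exact: lt_le_trans phi1. Qed.

Lemma max_profit_le1 i : max_profit i <= 1.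
Proof. by rewrite ge_min lexx. Qed.

Lemma max_profit_ge i : phi^-1 <= max_profit i.
Proof.
rewrite le_min invf_le1// phi1/=; rewrite -[leLHS]mul1r ler_pM2r ?invr_gt0//.
case: ifP => // _; case: ifP => // _.
by rewrite -[leLHS]mulr1 ler_pM ?exprn_ege1 ?ler1n.
Qed.

Definition hard_instance : smoothed_instance R n 1 :=
  @SmoothedInstance R n 1
    (one_group_knapsack (@binary_weight R n m) (@prefix_or_blocks n m g L))
    (fun i _ => uniform_density phi (max_profit i))
    (fun i _ => uniform_density_wf phi1 (max_profit_le1 i) (max_profit_ge i)).

Lemma hard_instance_bounded : densities_bounded hard_instance phi.
Proof. by move=> i j x _; apply: uniform_density_le. Qed.

Hypothesis a_gt0 : (0 < a)%N.
Hypothesis g_gt0 : (0 < g)%N.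
Hypothesis mn : (a + k + g * L <= n)%N.
Hypothesis doubling_le : forall i, (i < k)%N -> 2 ^+ i * a.+1%:R <= phi.
(** Divided by [phi]: [g] profits of at least [1 - phi^-1] reach the bound on the total of the first
    [m] objects. *)
Hypothesis block_ge : (0 < L)%N -> 2 ^+ k * a.+1%:R - 1 <= g%:R * (phi - 1).

Let K := (4 * a)%N.
Let e : R := phi^-1 / K%:R.

Let K_gt0 : 0 < K%:R :> R. Proof. by rewrite ltr0n /K; lia. Qed.
Let e_gt0 : 0 < e. Proof. by rewrite divr_gt0 ?invr_gt0. Qed.
Let Ke : K%:R * e = phi^-1. Proof. by rewrite /e mulrC mulfVK// gt_eqF. Qed.

(** Half-open, so that cells are disjoint and profits stay strictly below [max_profit i]. *)
Definition cell (kap : {ffun 'I_n -> 'I_K}) (i : 'I_n) : set R :=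
  `[max_profit i - phi^-1 + (kap i)%:R * e,
    max_profit i - phi^-1 + (kap i).+1%:R * e[%classic.

Lemma num_pareto_ge (kap : {ffun 'I_n -> 'I_K}) (p : 'I_n -> 'I_1 -> R) :
  (forall i j, cell kap i (p i j)) ->
  (L.+1 * 2 ^ k * front_size (cell_seq kap) a <= num_pareto hard_instance p)%N.
Proof.
move=> pcell.
have lo i : 0 <= max_profit i - phi^-1 by rewrite subr_ge0 max_profit_ge.
have p_ge i j : max_profit i - phi^-1 <= p i j.
  have := pcell i j; rewrite /cell /= in_itv/= => /andP[+ _].
  by apply: le_trans; rewrite lerDl mulr_ge0 ?(ltW e_gt0).
have p_lt i j : p i j < max_profit i.
  have := pcell i j; rewrite /cell /= in_itv/= => /andP[_ /lt_le_trans]; apply.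
  have : (kap i).+1%:R * e <= K%:R * e by rewrite ler_wpM2r ?(ltW e_gt0)// ler_nat.
  by rewrite Ke; lra.
have p0 i j : 0 <= p i j by apply: le_trans (p_ge i j).
have n0 : (0 < n)%N by lia.
rewrite /num_pareto feasible_one_group//.
have early (i : 'I_n) : (i < a)%N -> max_profit i = phi^-1.
  by move=> ia; rewrite /max_profit ia mul1r (min_idPr _)// invf_le1.
have chain (i : 'I_n) : (a <= i < a + k)%N ->
    max_profit i = 2 ^+ (i - a) * a.+1%:R * phi^-1.
  move=> /andP[ai ik]; rewrite /max_profit ltnNge ai /m ik /= (min_idPr _)//.
  by rewrite ler_pdivrMr// mul1r doubling_le//; lia.
have late (i : 'I_n) : (m <= i)%N -> max_profit i = 1.
  move=> mi; rewrite /max_profit ifF; last by rewrite /m in mi; lia.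
  by rewrite ltnNge mi /= divff ?gt_eqF// minxx.
have am : (a <= m)%N by rewrite /m; lia.
have an : (a <= n)%N by lia.
have box (i : 'I_n) : (i < a)%N ->
    (cell_seq kap i)%:R * e <= p i ord0 < (cell_seq kap i).+1%:R * e.
  move=> ia; rewrite cell_seqE; have := pcell i ord0.
  by rewrite /cell /= in_itv/= early// subrr !add0r.
have [_ fa] := front_below_box p0 e_gt0 am an box (leqnn a).
have pa (i : 'I_n) : (i < a)%N -> p i ord0 < phi^-1.
  by move=> ia; rewrite -(early i ia).
have pk (i : 'I_n) : (a <= i < a + k)%N ->
    (2 ^+ (i - a) * a.+1%:R - 1) * phi^-1 <= p i ord0 <
      2 ^+ (i - a) * a.+1%:R * phi^-1.
  by move=> ik; rewrite mulrBl mul1r -chain// p_ge p_lt.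
have akn : (a + k <= n)%N by lia.
have phiV0 : 0 <= phi^-1 by rewrite invr_ge0 ltW.
have [pm fm] :=
  card_front_doubling p0 phiV0 a_gt0 (leqnn m) akn pa pk (leqnn k).
have b0 : 0 <= 1 - phi^-1 by rewrite subr_ge0 invf_le1.
have pb (i : 'I_n) : (m <= i)%N -> 1 - phi^-1 <= p i ord0.
  by move=> mi; rewrite -(late i mi).
apply: leq_trans (card_pareto_copies p0 g_gt0 mn b0 pb _).
  by rewrite -mulnA leq_mul2l; apply: leq_trans fm; rewrite leq_mul2l fa orbT.
move=> L0; apply: (lt_le_trans pm).
have -> : 1 - phi^-1 = (phi - 1) * phi^-1 by rewrite mulrBl divff ?gt_eqF// mul1r.
by rewrite mulrA ler_wpM2r// block_ge.
Qed.

(** By independence every choice of cells has probability [K ^- n], so the expectation is at least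
    the average of the bounds in [num_pareto_ge]. *)
Lemma hard_instance_expectation (dT : measure_display) (T : measurableType dT)
    (P : probability T R) (p : 'I_n -> 'I_1 -> {RV P >-> R}) :
  random_profits hard_instance p ->
  ((L.+1%:R * 2 ^+ k * (a%:R ^+ 2 / 32))%:E
   <= 'E_P[fun t => (num_pareto hard_instance (fun i j => p i j t))%:R])%E.
Proof.
move=> [indep dens].
pose B (kap : {ffun 'I_n -> 'I_K}) : set T :=
  \bigcap_(ij in [set` [set: 'I_n * 'I_1]%SET]) (p ij.1 ij.2 @^-1` cell kap ij.1).
pose v (kap : {ffun 'I_n -> 'I_K}) : R :=
  (L.+1 * 2 ^ k * front_size (cell_seq kap) a)%:R.
have BP kap t : B kap t <-> forall i j, cell kap i (p i j t).
  split=> [Bt i j|Bt [i j] _]; last exact: Bt.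
  by apply: (Bt (i, j)); rewrite /= inE.
have mcell kap i : measurable (cell kap i) by exact: measurable_itv.
pose N : R := #|{ffun 'I_n -> 'I_K}|%:R.
have NE : N = K%:R ^+ n by rewrite /N card_ffun !card_ord natrX.
have cellP kap i j : P (p i j @^-1` cell kap i) = (K%:R^-1)%:E.
  rewrite (uniform_probability phi1 (max_profit_le1 i) (max_profit_ge i) (dens i j)).
  - by congr EFin; rewrite /e -addn1 natrD; field; rewrite !gt_eqF.
  - by rewrite lerDl mulr_ge0// ltW.
  - by rewrite ltrD2l ltr_pM2r// ltr_nat.
  - have : (kap i).+1%:R * e <= K%:R * e by rewrite ler_wpM2r ?(ltW e_gt0)// ler_nat.
    by rewrite Ke; lra.
have PB kap : P (B kap) = (N^-1)%:E.
  rewrite indep//; congr EFin; rewrite NE -exprVn.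
  rewrite (eq_bigr (fun=> K%:R^-1)) => [|[i j] _]; last by rewrite cellP.
  by rewrite prodr_const cardsT card_prod !card_ord muln1.
apply: le_trans (@expectation_ge _ _ _ P _ B v N^-1 _ _ PB _ _ _ _); first last.
- by move=> kap t /BP/num_pareto_ge; rewrite ler_nat.
- by move=> t; rewrite ler0n.
- by move=> kap; rewrite ler0n.
- move=> kap kap' t /BP Bt /BP Bt'; apply/ffunP => i; apply/val_inj/eqP.
  have := Bt i ord0; have := Bt' i ord0; rewrite /cell /= !in_itv/=.
  move=> /andP[l' u'] /andP[l u]; rewrite eqn_leq.
  have := le_lt_trans l u'; have := le_lt_trans l' u.
  by rewrite !ltrD2l !ltr_pM2r// !ltr_nat !ltnS => -> ->.
- move=> kap; apply: fin_bigcap_measurable; first exact: finite_finset.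
  by move=> [i j] _; apply: measurable_funPTI.
rewrite lee_fin /v; under eq_bigr do rewrite natrM natrM natrX.
rewrite -mulr_sumr [leRHS]mulrCA ler_wpM2l ?mulr_ge0 ?exprn_ge0//.
have N0 : 0 < N by rewrite NE exprn_gt0.
rewrite [leRHS]mulrC ler_pdivlMr// [leLHS]mulrC.
by apply: sum_front_ge => //; lia.
Qed.

End Instance.

(** * Choice of the sizes *)

Lemma max_doublings (R : realType) (x y : R) (K : nat) : x <= y ->
  exists k, [/\ (k <= K)%N, 2 ^+ k * x <= y & k = K \/ y < 2 ^+ k.+1 * x].
Proof.
move=> xy; elim: K => [|K [k [kK ky [kE|yk]]]].
- by exists 0%N; split; [|rewrite mul1r|left].
- have [h|h] := leP (2 ^+ k.+1 * x) y.
    by exists k.+1; split; [|exact: h|left; rewrite kE].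
  by exists k; split; [exact: leqW|exact: ky|right].
- by exists k; split; [exact: leqW|exact: ky|right].
Qed.

(** Here [a] is [n / 4] rounded up, hence positive, while [k] never exceeds [n / 4]; about half of
    the objects remain for the blocks. *)
Lemma instance_parameters (R : realType) (n : nat) (phi : R) :
  (0 < n)%N -> 1 <= phi ->
  let a := ((n + 3) %/ 4)%N in
  exists k g L : nat,
  [/\ (0 < g)%N, (a + k + g * L <= n)%N,
      forall i, (i < k)%N -> 2 ^+ i * a.+1%:R <= phi,
      (0 < L)%N -> 2 ^+ k * a.+1%:R - 1 <= g%:R * (phi - 1) &
      k = (n %/ 4)%N \/ phi <= 4 * (L.+1%:R * 2 ^+ k)].
Proof.
move=> n0 phi1 a.
have a0 : (0 < a)%N by rewrite /a; lia.
have [phi2|phi2] := leP phi 2.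
  exists 0%N, 1%N, 0%N; split=> //; first by rewrite /a; lia.
  by right; rewrite mul1r mulr1; lra.
have [phia|aphi] := ltP phi a.+1%:R.
  (* The least [g] with [g * (phi - 1) > a]; as [phi - 1 < a], rounding up keeps [g * (phi - 1)]
     within [2 * a]. *)
  pose g := (Num.truncn (a%:R / (phi - 1))).+1.
  have p10 : 0 < phi - 1 by lra.
  have /andP[g1 g2] : (Num.truncn (a%:R / (phi - 1)))%:R <= a%:R / (phi - 1) < g%:R.
    by apply: truncn_itv; rewrite divr_ge0// ltW.
  rewrite ler_pdivlMr// in g1; rewrite ltr_pdivrMr// in g2.
  have ga : g%:R * (phi - 1) <= 2 * a%:R.
    by move: phia; rewrite /g -!natr1 mulrDl; lra.
  exists 0%N, g, ((n - a) %/ g)%N; split=> //.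
  - have := leq_divM (n - a) g; rewrite /a; lia.
  - by move=> _; rewrite mul1r -natr1 addrK ltW.
  - right; rewrite mulr1.
    have a2 : (1 < a)%N.
      by have := lt_trans phi2 phia; rewrite ltr_nat ltnS.
    have : ((n - a) < g * ((n - a) %/ g).+1)%N by rewrite mulnC ltn_ceil.
    set l := (_ %/ g).+1 => gl.
    have : (a <= g * l)%N by rewrite /a in a2 gl *; lia.
    rewrite -(ler_nat R) natrM => agl.
    have : a%:R * (phi - 1) <= l%:R * (g%:R * (phi - 1)).
      by rewrite mulrA [l%:R * _]mulrC ler_wpM2r// ltW.
    move=> /le_trans /(_ (ler_wpM2l (ler0n _ _) ga)).
    have -> : l%:R * (2 * a%:R) = a%:R * (2 * l%:R) :> R by ring.
    rewrite ler_pM2l ?ltr0n//.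
    (* From [phi - 1 <= 2 * l], using [phi <= 2 * (phi - 1)] for [phi > 2]. *)
    lra.
have [k [kn kphi kmax]] := max_doublings (n %/ 4) aphi.
(* One object outweighs the earlier ones, so each remaining object forms its own step of the
   blocks. *)
exists k, 1%N, (n - a - k)%N; split=> //.
- by rewrite /a; lia.
- move=> i ik; apply: le_trans kphi; rewrite ler_pM2r ?ltr0n//.
  by rewrite ler_eXn2l ?ltr1n// ltnW.
- by move=> _; rewrite mul1r lerB.
case: kmax => [->|kmax]; [by left|right].
apply: (le_trans (ltW kmax)).
have -> : 2 ^+ k.+1 * a.+1%:R = 2 * a.+1%:R * 2 ^+ k :> R by rewrite exprS; ring.
by rewrite mulrA ler_wpM2r ?exprn_ge0// -!natrM ler_nat /a; lia.
Qed.

Theorem theorem1 (R : realType) :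
  exists (C : forall n : nat, set (smoothed_instance R n 1))
         (c : R) (theta : R -> R) (tau : nat -> R),
  [/\ 0 < c,
      is_Theta [set phi : R | 1 <= phi] theta (fun phi => phi^-1),
      is_Theta [set: nat] tau (fun n => n%:R) &
      forall (n : nat) (phi : R), 1 <= phi ->
      exists I : smoothed_instance R n 1,
      [/\ C n I,
          densities_bounded I phi &
          forall (dT : measure_display) (T : measurableType dT)
                 (P : probability T R) (p : 'I_n -> 'I_1 -> {RV P >-> R}),
          random_profits I p ->
          ((c * Num.min (n%:R ^+ 2 * phi `^ (1 - theta phi)) (2 `^ tau n))%:E
           <= 'E_P[fun t => (num_pareto I (fun i j => p i j t))%:R])%E]].
Proof.
(* The class consists of all instances; [hard_instance] is the one exhibited. The constant combines
   [M * a ^ 2 / 32] with [n ^ 2 <= 16 * a ^ 2] and [phi <= 4 * M], where [M] is [L.+1 * 2 ^ k]. *)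
exists (fun n => [set: smoothed_instance R n 1]), (32^-1 / 64), (fun phi => phi^-1),
  (fun n => n%:R / 4).
have c0 : 0 < 32^-1 / 64 :> R by rewrite divr_gt0 ?invr_gt0 ?ltr0n.
split; first exact: c0.
- by exists 1, 1; split=> // phi _; rewrite mul1r lexx.
- by exists (4^-1), (4^-1); split; rewrite ?invr_gt0// => n _; rewrite mulrC lexx.
move=> n phi phi1.
have [->|n0] := posnP n.
  exists (@hard_instance R 0 0 0 0 0 phi phi1); split=> //.
    exact: hard_instance_bounded.
  move=> dT T P p _; rewrite expr0n mul0r/= (min_idPl (powR_ge0 _ _)) mulr0.
  by rewrite expectation.unlock; apply: integral_ge0 => t _; rewrite lee_fin.
have [k [g [L [g0 mn dbl blk big]]]] := instance_parameters n0 phi1.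
set a := ((n + 3) %/ 4)%N in mn dbl blk.
have a0 : (0 < a)%N by rewrite /a; lia.
exists (@hard_instance R n a k g L phi phi1); split=> //.
  exact: hard_instance_bounded.
move=> dT T P p rp.
apply: le_trans (hard_instance_expectation a0 g0 mn dbl blk rp).
rewrite lee_fin; set M : R := L.+1%:R * 2 ^+ k in big *.
have na : n%:R ^+ 2 <= 16 * a%:R ^+ 2 :> R.
  have : n%:R <= 4 * a%:R :> R by rewrite -natrM ler_nat /a; lia.
  by have : 0 <= n%:R :> R by []; nra.
have M0 : 0 <= M by rewrite mulr_ge0// exprn_ge0.
case: big => [kn|phiM].
- apply: (@le_trans _ _ (32^-1 / 64 * 2 `^ (n%:R / 4))).
    by rewrite (ler_pM2l c0) ge_min lexx orbT.
  (* Since [k] is [n / 4] rounded down, [n / 4 <= k.+1]. *)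
  have k1 : 2 `^ (n%:R / 4) <= 2 * M.
    apply: (@le_trans _ _ (2 `^ k.+1%:R)).
      rewrite ler_powR ?ler1n// ler_pdivrMr// -natrM ler_nat kn; lia.
    by rewrite powR_mulrn// exprS ler_pM2l// ler_peMl ?exprn_ge0// ler1n.
  have a1 : 1 <= a%:R ^+ 2 :> R by rewrite exprn_ege1// ler1n.
  have : 0 <= M * (a%:R ^+ 2 - 1) by rewrite mulr_ge0// subr_ge0.
  lra.
- apply: (@le_trans _ _ (32^-1 / 64 * (n%:R ^+ 2 * phi `^ (1 - phi^-1)))).
    by rewrite (ler_pM2l c0) ge_min lexx.
  (* As [phi >= 1], lowering the exponent from 1 only decreases the power. *)
  have phiE : phi `^ (1 - phi^-1) <= 4 * M.
    apply: le_trans phiM; rewrite -[leRHS]powRr1 ?(le_trans ler01)//.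
    by rewrite ler_powR// gerBl invr_ge0 (le_trans ler01).
  have := ler_pM (sqr_ge0 n%:R) (powR_ge0 _ _) na phiE.
  lra.
Qed.
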